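(* Let $p$ be an odd prime number, let $k$ be a field of characteristic $p$, and let $R = k[s,x,y]/(xy(x-y)(x+y-sy))$. Let $J = (x^p, y^p)$ and $I = (x,y)^p$, ideals of $R$, and let $\mathfrak{p} = (x,y)R$ and $\mathfrak{m} = (s,x,y)R$, so that $\mathfrak{p} \subsetneq \mathfrak{m}$ are prime ideals of $R$. Then for every $q = p^e$ with $e \geq 1$ an integer: (a) $\mathfrak{p} \in \operatorname{Ass}_R(I^{[q]}/J^{[q]})$ and $\mathfrak{m} \in \operatorname{Ass}_R(I^{[q]}/J^{[q]})$; (b) $\lambda_R\big(H^0_{\mathfrak{m}}(I^{[q]}/J^{[q]})\big) \leq 1$. Moreover, the relative multiplicity $u_{R_{\mathfrak{m}}}(J_{\mathfrak{m}}, I_{\mathfrak{m}})$ is well-defined (that is, the limit defining it exists) and $$u_{R_{\mathfrak{m}}}(J_{\mathfrak{m}}, I_{\mathfrak{m}}) = 0.$$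
   Context: For an ideal $\mathfrak{a}$ of a ring of prime characteristic $p$ and $q = p^e$, $\mathfrak{a}^{[q]}$ denotes the ideal generated by all $a^q$ with $a \in \mathfrak{a}$ (the Frobenius power). $\lambda$ denotes length. For a module $M$ and an ideal $\mathfrak{m}$, $\Gamma_{\mathfrak{m}}(M) = H^0_{\mathfrak{m}}(M) = \{z \in M : \mathfrak{m}^i z = 0 \text{ for some } i \geq 1\}$. $\operatorname{Ass}_R(M)$ is the set of associated primes of $M$. Relative multiplicity: let $(S,\mathfrak{n})$ be a Noetherian local ring of prime characteristic $p$ and dimension $d$, and let $J' \subseteq I'$ be ideals of $S$. Set $$u^+_S(J',I') = \limsup_{q \to \infty} \frac{\lambda(\Gamma_{\mathfrak{n}}(I'^{[q]}/J'^{[q]}))}{q^d}, \qquad u^-_S(J',I') = \liminf_{q \to \infty} \frac{\lambda(\Gamma_{\mathfrak{n}}(I'^{[q]}/J'^{[q]}))}{q^d},$$ where $q$ ranges over the powers of $p$. If these are equal, the common value is denoted $u_S(J',I')$. *)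

(* Defs.v *)
From HB Require Import structures.
From mathcomp Require Import all_boot all_order all_algebra ring.
From mathcomp Require Import generic_quotient ring_quotient.
From mathcomp Require Import boolp classical_sets reals ereal sequences exp.

Set Implicit Arguments.
Unset Strict Implicit.
Unset Printing Implicit Defensive.

Import Order.TTheory GRing.Theory Num.Theory.

Local Open Scope ring_scope.
Local Open Scope quotient_scope.
Local Open Scope classical_set_scope.

Record submodule (R : comNzRingType) (M : lmodType R) := Submodule {
  submod_pred :> {pred M};
  submod_subproof : submod_closed submod_pred }.

Section SubmoduleInstances.
Variables (R : comNzRingType) (M : lmodType R) (N : submodule M).

HB.instance Definition _ :=
  GRing.isZmodClosed.Build M (submod_pred N) (GRing.submod_closedB (submod_subproof N)).
HB.instance Definition _ :=
  GRing.isSubmodClosed.Build R M (submod_pred N) (submod_subproof N).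

Definition submod_type := {x : M | x \in submod_pred N}.

HB.instance Definition _ := [isSub of submod_type for (@sval M _)].
HB.instance Definition _ := [Choice of submod_type by <:].
HB.instance Definition _ := [SubChoice_isSubLmodule of submod_type by <:].

Definition quot_mod := Quotient.quot (submod_pred N).

HB.instance Definition _ := GRing.Zmodule.on quot_mod.
HB.instance Definition _ :=
  ZmodQuotient.copy quot_mod (Quotient.quot (submod_pred N)).

Definition quot_scale (a : R) (z : quot_mod) : quot_mod :=
  \pi_quot_mod (a *: repr z).

Lemma quot_scaleE a x :
  quot_scale a (\pi_quot_mod x)
  = \pi_quot_mod (a *: x).
Proof.
apply/eqP; rewrite -Quotient.idealrBE -scalerBr rpredZ //.
by rewrite Quotient.idealrBE reprK.
Qed.

Lemma quot_scaleA a b z : quot_scale a (quot_scale b z) = quot_scale (a * b) z.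
Proof. by elim/quotW: z => x; rewrite (quot_scaleE b x) !quot_scaleE scalerA. Qed.

Lemma quot_scale1 : left_id 1 quot_scale.
Proof. by elim/quotW => x; rewrite quot_scaleE scale1r. Qed.

Lemma quot_scaleDr : right_distributive quot_scale +%R.
Proof.
move=> a; elim/quotW => x; elim/quotW => y.
by rewrite -(raddfD \pi_quot_mod) !quot_scaleE scalerDr raddfD.
Qed.

Lemma quot_scaleDl z : {morph quot_scale^~ z : a b / a + b}.
Proof.
elim/quotW: z => x a b.
by rewrite !quot_scaleE scalerDl raddfD.
Qed.

HB.instance Definition _ := GRing.Zmodule_isLmodule.Build R quot_mod
  quot_scaleA quot_scale1 quot_scaleDr quot_scaleDl.

End SubmoduleInstances.

Section SubmoduleOps.
Variables (R : comNzRingType) (M : lmodType R).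
Implicit Types (N L : submodule M) (A : set M).

(* The submodule generated by [A], as the intersection of the submodules
   containing [A]. *)
Definition submod_span_pred A : {pred M} :=
  fun x => `[< forall N, (forall a, A a -> a \in N) -> x \in N >].

Lemma submod_span_closed A : submod_closed (submod_span_pred A).
Proof.
split=> [|a x y /asboolP xA /asboolP yA]; apply/asboolP => N AN.
  exact: rpred0.
by rewrite rpredD ?rpredZ ?xA ?yA.
Qed.

Definition submod_span A : submodule M := Submodule (submod_span_closed A).

Definition submod_restrict_pred L N : {pred submod_type L} := fun z => val z \in N.

Lemma submod_restrict_closed L N : submod_closed (@submod_restrict_pred L N).
Proof.
split=> [|a x y xN yN]; rewrite unfold_in /submod_restrict_pred.
  by rewrite raddf0 rpred0.
by rewrite linearD linearZ rpredD ?rpredZ.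
Qed.

Definition submod_restrict L N : submodule (submod_type L) :=
  Submodule (@submod_restrict_closed L N).

(* [L / (N :&: L)], which is [L / N] whenever [N] is contained in [L]. *)
Definition subquot L N : lmodType R := quot_mod (submod_restrict L N).

Definition chain_of_submodules (n : nat) (C : nat -> submodule M) : Prop :=
  forall i, (i < n)%N ->
    {subset C i <= C i.+1} /\ ~ {subset C i.+1 <= C i}.

End SubmoduleOps.

Notation ideal R := (submodule R^o).

Section Ideals.
Variable R : comNzRingType.
Implicit Types (I J P : ideal R).

Definition ideal_gen (A : set R) : ideal R := @submod_span R R^o A.

Definition unit_ideal : ideal R := ideal_gen [set 1].

Definition ideal_mul I J : ideal R :=
  ideal_gen [set c | exists a b : R, [/\ a \in I, b \in J & c = a * b]].

Definition ideal_exp I n : ideal R := iter n (ideal_mul I) unit_ideal.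

Definition frobenius_power I q : ideal R :=
  ideal_gen [set c | exists2 a : R, a \in I & c = a ^+ q].

Definition is_prime P : Prop :=
  (1 : R) \notin P /\ prime_idealr_closed (P : {pred R}).

End Ideals.

Definition ideal_ext (R S : comNzRingType) (f : R -> S) (I : ideal R) : ideal S :=
  ideal_gen [set c | exists2 a : R, a \in I & c = f a].

Section ModuleInvariants.
Variables (R : comNzRingType) (M : lmodType R).

Definition associated_prime (P : ideal R) : Prop :=
  is_prime P /\ exists z : M, forall a : R, (a \in P) = (a *: z == 0).

Definition torsion_pred (I : ideal R) : {pred M} :=
  fun z => `[< exists2 i, (0 < i)%N & forall a : R, a \in ideal_exp I i -> a *: z = 0 >].

Lemma ideal_exp_sub (I : ideal R) i j (a : R) :
  a \in ideal_exp I (i + j) -> a \in ideal_exp I j.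
Proof.
elim: i a => [//|i IHi] a /asboolP; apply=> _ [b [c [_ cI ->]]].
by apply: (@rpredZ _ R^o (ideal_exp I j : submodClosed R^o) b c); apply: IHi.
Qed.

Lemma torsion_closed I : submod_closed (torsion_pred I).
Proof.
split=> [|r x y /asboolP[i i_gt0 xi] /asboolP[j j_gt0 yj]]; apply/asboolP.
  by exists 1 => // a _; rewrite scaler0.
exists (i + j)%N; first by rewrite addn_gt0 i_gt0.
move=> a aI; rewrite scalerDr scalerA mulrC -scalerA.
rewrite (yj _ (ideal_exp_sub aI)) xi ?scaler0 ?addr0 //.
by apply: (@ideal_exp_sub I j); rewrite addnC.
Qed.

(* [Gamma_I(M) = H^0_I(M)]. *)
Definition mod_torsion (I : ideal R) : submodule M := Submodule (@torsion_closed I).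

End ModuleInvariants.

Arguments associated_prime {R} M P.
Arguments mod_torsion {R} M I.

(* Length as the supremum of the lengths of strict chains of submodules. *)
Definition mod_length (F : realType) (R : comNzRingType) (M : lmodType R) : \bar F :=
  ereal_sup [set n%:R%:E | n in
    [set n : nat | exists C : nat -> submodule M, chain_of_submodules n C]].

(* Krull dimension as the supremum of the lengths of strict chains of primes. *)
Definition krull_dim (F : realType) (R : comNzRingType) : \bar F :=
  ereal_sup [set n%:R%:E | n in
    [set n : nat | exists C : nat -> ideal R,
       (forall i, (i <= n)%N -> is_prime (C i)) /\ chain_of_submodules n C]].

(* [q ^ d] for a dimension [d]. Over a Noetherian local ring [d] is a natural
   number, so only the first branch, the usual power, is relevant there. *)
Definition pow_dim (F : realType) (q : nat) (d : \bar F) : \bar F :=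
  match d with
  | r%:E => (q%:R `^ r)%:E
  | +oo => +oo
  | -oo => 0
  end%E.

Section RelativeMultiplicity.
Variables (F : realType) (p : nat) (S : comNzRingType).
(* [n] is meant to be the maximal ideal of the local ring [S]. *)
Variables (n J I : ideal S).

(* [lambda (Gamma_n (I^[q] / J^[q])) / q ^ dim S] for [q = p ^ e]; the limit over
   the powers [q] of [p] is the limit in [e]. *)
Definition rel_mult_seq (e : nat) : \bar F :=
  let q := (p ^ e)%N in
  (mod_length F (submod_type
     (mod_torsion (subquot (frobenius_power I q) (frobenius_power J q)) n))
   / pow_dim q (krull_dim F S))%E.

Definition rel_mult_sup : \bar F := limn_esup rel_mult_seq.
Definition rel_mult_inf : \bar F := limn_einf rel_mult_seq.

Definition rel_mult_is (c : \bar F) : Prop :=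
  rel_mult_sup = c /\ rel_mult_inf = c.

End RelativeMultiplicity.

Section Localization.
Variables (R : comNzRingType) (P : ideal R) (P_prime : is_prime P).

Definition loc_denom := {s : R | s \notin P}.

Lemma denom1 : (1 : R) \notin P. Proof. exact: P_prime.1. Qed.

Lemma denomM (s t : loc_denom) : sval s * sval t \notin P.
Proof.
apply/negP => /P_prime.2.
by rewrite (negPf (svalP s)) (negPf (svalP t)).
Qed.

Definition one_denom : loc_denom := exist _ 1 denom1.
Definition mul_denom (s t : loc_denom) : loc_denom := exist _ (sval s * sval t) (denomM s t).

(* [a/s = b/t] iff [w(at - bs) = 0] for some denominator [w]; [R] may have
   zero divisors. *)
Definition frac_equiv (u v : R * loc_denom) : bool :=
  `[< exists w : loc_denom, sval w * (u.1 * sval v.2) = sval w * (v.1 * sval u.2) >].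

Lemma frac_equiv_is_equiv : equiv_class_of frac_equiv.
Proof.
split=> [u|u v|v u w].
- by apply/asboolP; exists one_denom.
- by apply/asboolP/asboolP => -[t tE]; exists t.
move=> /asboolP[s sE] /asboolP[t tE]; apply/asboolP.
exists (mul_denom (mul_denom s t) v.2) => /=.
have -> : sval s * sval t * sval v.2 * (u.1 * sval w.2)
   = (sval s * (u.1 * sval v.2)) * (sval t * sval w.2) by ring.
rewrite sE.
have -> : sval s * (v.1 * sval u.2) * (sval t * sval w.2)
   = (sval t * (v.1 * sval w.2)) * (sval s * sval u.2) by ring.
by rewrite tE; ring.
Qed.

Canonical frac_equiv_equiv := EquivRelPack frac_equiv_is_equiv.
Canonical frac_encModRel := defaultEncModRel frac_equiv.

Definition localization := {eq_quot frac_equiv}.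
HB.instance Definition _ : EqQuotient _ frac_equiv localization :=
  EqQuotient.on localization.
HB.instance Definition _ := Choice.on localization.

Definition loc_frac (a : R) (s : loc_denom) : localization := \pi_localization (a, s).

Lemma loc_fracP a s b t :
  loc_frac a s = loc_frac b t <->
  exists w : loc_denom, sval w * (a * sval t) = sval w * (b * sval s).
Proof.
split=> [/eqmodP/asboolP //|H]; apply/eqmodP/asboolP; exact: H.
Qed.

Lemma loc_fracW (T : localization -> Prop) :
  (forall a s, T (loc_frac a s)) -> forall z, T z.
Proof. by move=> H; elim/quotW => -[a s]; apply: H. Qed.

Definition loc_op1 (f : R * loc_denom -> R * loc_denom) (z : localization) :=
  \pi_localization (f (repr z)).
Definition loc_op2 (f : R * loc_denom -> R * loc_denom -> R * loc_denom)
  (z w : localization) := \pi_localization (f (repr z) (repr w)).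

Lemma repr_frac a s :
  exists w : loc_denom, sval w * ((repr (loc_frac a s)).1 * sval s)
    = sval w * (a * sval (repr (loc_frac a s)).2).
Proof. by apply/loc_fracP; rewrite /loc_frac -surjective_pairing reprK. Qed.

Definition loc_opp := loc_op1 (fun u => (- u.1, u.2)).
Definition loc_add := loc_op2 (fun u v =>
  (u.1 * sval v.2 + v.1 * sval u.2, mul_denom u.2 v.2)).
Definition loc_mul := loc_op2 (fun u v => (u.1 * v.1, mul_denom u.2 v.2)).

Lemma loc_oppE a s : loc_opp (loc_frac a s) = loc_frac (- a) s.
Proof.
apply/loc_fracP; have [w wE] := repr_frac a s; exists w.
by rewrite !mulNr !mulrN wE.
Qed.

Lemma loc_addE a s b t :
  loc_add (loc_frac a s) (loc_frac b t) = loc_frac (a * sval t + b * sval s) (mul_denom s t).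
Proof.
apply/loc_fracP; have [w] := repr_frac a s; have [v] := repr_frac b t.
case: (repr (loc_frac a s)) (repr (loc_frac b t)) => [a' s'] [b' t'] /= vE wE.
exists (mul_denom w v) => /=.
have -> : sval w * sval v * ((a' * sval t' + b' * sval s') * (sval s * sval t))
  = (sval w * (a' * sval s)) * (sval v * sval t' * sval t)
  + (sval v * (b' * sval t)) * (sval w * sval s' * sval s) by ring.
by rewrite vE wE; ring.
Qed.

Lemma loc_mulE a s b t :
  loc_mul (loc_frac a s) (loc_frac b t) = loc_frac (a * b) (mul_denom s t).
Proof.
apply/loc_fracP; have [w] := repr_frac a s; have [v] := repr_frac b t.
case: (repr (loc_frac a s)) (repr (loc_frac b t)) => [a' s'] [b' t'] /= vE wE.
exists (mul_denom w v) => /=.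
have -> : sval w * sval v * (a' * b' * (sval s * sval t))
  = (sval w * (a' * sval s)) * (sval v * (b' * sval t)) by ring.
by rewrite vE wE; ring.
Qed.

Lemma loc_frac_eq a s b t : a * sval t = b * sval s -> loc_frac a s = loc_frac b t.
Proof. by move=> E; apply/loc_fracP; exists one_denom; rewrite E. Qed.

Let zero := loc_frac 0 one_denom.
Let one := loc_frac 1 one_denom.

Lemma loc_addA : associative loc_add.
Proof.
elim/loc_fracW=> a s; elim/loc_fracW=> b t; elim/loc_fracW=> c u.
by rewrite !(loc_addE a, loc_addE b, loc_addE) /=; apply: loc_frac_eq => /=; ring.
Qed.

Lemma loc_addC : commutative loc_add.
Proof.
elim/loc_fracW=> a s; elim/loc_fracW=> b t.
by rewrite !loc_addE; apply: loc_frac_eq => /=; ring.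
Qed.

Lemma loc_add0 : left_id zero loc_add.
Proof.
by elim/loc_fracW=> a s; rewrite loc_addE; apply: loc_frac_eq => /=; ring.
Qed.

Lemma loc_addN : left_inverse zero loc_opp loc_add.
Proof.
by elim/loc_fracW=> a s; rewrite loc_oppE loc_addE; apply: loc_frac_eq => /=; ring.
Qed.

HB.instance Definition _ :=
  GRing.isZmodule.Build localization loc_addA loc_addC loc_add0 loc_addN.

Lemma loc_mulA : associative loc_mul.
Proof.
elim/loc_fracW=> a s; elim/loc_fracW=> b t; elim/loc_fracW=> c u.
by rewrite !loc_mulE; apply: loc_frac_eq => /=; ring.
Qed.

Lemma loc_mulC : commutative loc_mul.
Proof.
elim/loc_fracW=> a s; elim/loc_fracW=> b t.
by rewrite !loc_mulE; apply: loc_frac_eq => /=; ring.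
Qed.

Lemma loc_mul1 : left_id one loc_mul.
Proof.
by elim/loc_fracW=> a s; rewrite loc_mulE; apply: loc_frac_eq => /=; ring.
Qed.

Lemma loc_mulDl : left_distributive loc_mul loc_add.
Proof.
elim/loc_fracW=> a s; elim/loc_fracW=> b t; elim/loc_fracW=> c u.
by rewrite !(loc_addE, loc_mulE); apply: loc_frac_eq => /=; ring.
Qed.

Lemma loc_one_neq0 : one != zero.
Proof.
apply/eqP => /loc_fracP[w] /=; rewrite !mul1r mul0r !mulr0 mulr1 => w0.
by have := svalP w; rewrite w0 (rpred0 P).
Qed.

HB.instance Definition _ := GRing.Zmodule_isComNzRing.Build localization
  loc_mulA loc_mulC loc_mul1 loc_mulDl loc_one_neq0.

Definition to_loc (a : R) : localization := loc_frac a one_denom.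

End Localization.

Section Example.
Variable k : fieldType.

(* [k[s,x,y]], represented as [k[s][x][y]]. *)
Notation A := {poly {poly {poly k}}}.

Definition pol_s : A := 'X%:P%:P.
Definition pol_x : A := 'X%:P.
Definition pol_y : A := 'X.

Definition pol_f : A :=
  pol_x * pol_y * (pol_x - pol_y) * (pol_x + pol_y - pol_s * pol_y).

Definition eval0 (g : A) : k := g.[0].[0].[0].

Lemma eval0D g h : eval0 (g + h) = eval0 g + eval0 h.
Proof. by rewrite /eval0 !hornerD. Qed.

Lemma eval0M g h : eval0 (g * h) = eval0 g * eval0 h.
Proof. by rewrite /eval0 !hornerM. Qed.

Lemma eval0_1 : eval0 1 = 1.
Proof. by rewrite /eval0 !hornerC. Qed.

Lemma eval0_s : eval0 pol_s = 0.
Proof. by rewrite /eval0 !(hornerC, hornerX). Qed.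

Lemma eval0_x : eval0 pol_x = 0.
Proof. by rewrite /eval0 !(hornerC, hornerX). Qed.

Lemma eval0_y : eval0 pol_y = 0.
Proof. by rewrite /eval0 !(hornerC, hornerX). Qed.

Lemma eval0_ker_closed : submod_closed ([pred g | eval0 g == 0] : {pred A^o}).
Proof.
split=> [|a u v]; rewrite !inE; first by rewrite /eval0 !horner0.
by move=> /eqP u0 /eqP v0; rewrite eval0D eval0M u0 v0 mulr0 addr0.
Qed.

Definition rel_ideal_pred : {pred A} := ideal_gen [set pol_f].

Lemma rel_ideal_sub (g : A) : g \in rel_ideal_pred -> eval0 g = 0.
Proof.
move/asboolP/(_ (Submodule eval0_ker_closed)) => H; apply/eqP/H => _ ->.
by rewrite inE /pol_f !eval0M eval0_x !mul0r.
Qed.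

Lemma rel_ideal_closed : idealr_closed rel_ideal_pred.
Proof.
have [I0 IL] := submod_subproof (ideal_gen [set pol_f]).
split=> //; apply/negP => /rel_ideal_sub /eqP.
by rewrite eval0_1 oner_eq0.
Qed.

HB.instance Definition _ := isIdealr.Build A rel_ideal_pred rel_ideal_closed.

(* [k[s,x,y]/(xy(x-y)(x+y-sy))]. *)
Definition exring : comNzRingType := {ideal_quot rel_ideal_pred}.

Definition ex_s : exring := \pi_{ideal_quot rel_ideal_pred} pol_s.
Definition ex_x : exring := \pi_{ideal_quot rel_ideal_pred} pol_x.
Definition ex_y : exring := \pi_{ideal_quot rel_ideal_pred} pol_y.

Definition ex_m : ideal exring := ideal_gen [set ex_s; ex_x; ex_y].

Definition eval0_quot (z : exring) : k :=
  eval0 (repr (z : {ideal_quot rel_ideal_pred})).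

Lemma eval0_pi (g : A) : eval0_quot (\pi_{ideal_quot rel_ideal_pred} g) = eval0 g.
Proof.
have /rel_ideal_sub : repr (\pi_{ideal_quot rel_ideal_pred} g) - g \in rel_ideal_pred.
  by rewrite Quotient.idealrBE reprK.
set h := repr _ => hg; rewrite /eval0_quot -/h.
by rewrite -[h](subrK g) eval0D hg add0r.
Qed.

Lemma exringW (T : exring -> Prop) :
  (forall g, T (\pi_{ideal_quot rel_ideal_pred} g)) -> forall z, T z.
Proof. by move=> H z; rewrite -[z](@reprK _ {ideal_quot rel_ideal_pred}). Qed.

Lemma eval0_quotM z w : eval0_quot (z * w) = eval0_quot z * eval0_quot w.
Proof.
elim/exringW: z => g; elim/exringW: w => h.
by rewrite -rmorphM !eval0_pi eval0M.
Qed.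

Lemma eval0_quotD z w : eval0_quot (z + w) = eval0_quot z + eval0_quot w.
Proof.
elim/exringW: z => g; elim/exringW: w => h.
by rewrite -rmorphD !eval0_pi eval0D.
Qed.

Lemma eval0_quot_ker_closed :
  submod_closed ([pred z | eval0_quot z == 0] : {pred exring^o}).
Proof.
split=> [|a u v]; rewrite !inE.
  by rewrite -(rmorph0 \pi_{ideal_quot rel_ideal_pred}) eval0_pi /eval0 !horner0.
by move=> /eqP u0 /eqP v0; rewrite eval0_quotD eval0_quotM u0 v0 mulr0 addr0.
Qed.

Lemma poly_split (B : comNzRingType) (g : {poly B}) : exists h, g = h * 'X + (g.[0])%:P.
Proof.
elim/poly_ind: g => [|h c _]; first by exists 0; rewrite mul0r horner0 add0r polyC0.
by exists h; rewrite hornerMXaddC mulr0 add0r.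
Qed.

Lemma ex_mE (z : exring) : (z \in ex_m) = (eval0_quot z == 0).
Proof.
apply/idP/idP => [/asboolP/(_ (Submodule eval0_quot_ker_closed)) H|].
  by apply: H => _ [[->|->]|->]; rewrite inE eval0_pi
    ?(eval0_s, eval0_x, eval0_y).
elim/exringW: z => g; rewrite eval0_pi => /eqP g0; apply/asboolP => N HN.
have mulN (a : exring) (b : A) : a \in N -> \pi_{ideal_quot rel_ideal_pred} b * a \in N.
  by move=> aN; apply: (@rpredZ _ exring^o (N : submodClosed exring^o)).
have [h ->] := poly_split g; have [h1 ->] := poly_split g.[0].
have [h2 ->] := poly_split g.[0].[0].
rewrite -/(eval0 g) g0 polyC0 addr0 !(rmorphD, rmorphM) /=.
have sN : ex_s \in N by apply: HN; left; left.
have xN : ex_x \in N by apply: HN; left; right.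
have yN : ex_y \in N by apply: HN; right.
by rewrite (rpredD (mulN _ _ yN)) // rpredD ?mulN.
Qed.

Lemma ex_m_prime : is_prime ex_m.
Proof.
split=> [|u v]; rewrite !ex_mE.
  by rewrite -(rmorph1 \pi_{ideal_quot rel_ideal_pred}) eval0_pi eval0_1 oner_eq0.
by rewrite eval0_quotM mulf_eq0.
Qed.

(* The localization of [exring] at its prime ideal [ex_m = (s,x,y)]; its maximal
   ideal is the extension of [ex_m]. *)
Definition ex_loc : comNzRingType := localization ex_m_prime.
Definition to_ex_loc : exring -> ex_loc := @to_loc _ _ ex_m_prime.

End Example.

(* Main.v *)
Require Import Defs.
From mathcomp Require Import all_boot all_order all_algebra.
From mathcomp Require Import boolp classical_sets reals ereal.
From mathcomp Require Import ring zify generic_quotient ring_quotient.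
From mathcomp Require Import topology normedtype sequences exp.

Set Implicit Arguments.
Unset Strict Implicit.
Unset Printing Implicit Defensive.

Import Order.TTheory GRing.Theory Num.Theory.
Import numFieldNormedType.Exports.

Local Open Scope ring_scope.
Local Open Scope classical_set_scope.

(**
Put N = pq, M = N - 1, r = s - 1, g = (x - y)(x - ry), so that f = xyg is the
defining equation and J^[q] = (x^N, y^N). Modulo g the powers of x reduce to
combinations of y^i and x y^(i-1), so everything is controlled by the images
of polynomials on the four lines f = 0. Evaluating at (t, t) and (rt, t) shows
that the k[s]-torsion of R/J^[q] is generated by w = x^2 y^(N-1), which is
killed by x and y, and
  r (r - 1) x^N y = (r^N - r) w  mod (y^N, f),   r^N - r = s^N - s = s E,
with E = s^(N-1) - 1 prime to s. Hence the s-power torsion is the line k E w,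
which gives (b), for R as well as for its localization; as dim R_m >= 1, the
relative multiplicity vanishes. The element (s^N - s) x^q y^(N-q) has
annihilator (x, y), and E x^(q+1) y^(N-q) is a nonzero socle element because q
is odd.
*)

(** * Ideals with two generators and their Frobenius powers *)

Section IdealTheory.
Variable S : comNzRingType.
Implicit Types (I J P : ideal S) (A : set S) (a b : S).

Lemma mem_ideal_gen A a : A a -> a \in ideal_gen A.
Proof. by move=> Aa; apply/asboolP => N; apply. Qed.

Lemma ideal_gen_min A I : (forall a : S, A a -> a \in I) -> {subset ideal_gen A <= I}.
Proof. by move=> AI u /asboolP; apply. Qed.

Lemma idealMl I a b : b \in I -> a * b \in I.
Proof. exact: (@rpredZ _ S^o (I : submodClosed S^o) a b). Qed.

Lemma idealD I a b : a \in I -> b \in I -> a + b \in I.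
Proof. exact: (@rpredD _ (I : submodClosed S^o)). Qed.

Lemma idealB I a b : a \in I -> b \in I -> a - b \in I.
Proof. exact: (@rpredB _ (I : submodClosed S^o)). Qed.

Lemma ideal0 I : 0 \in I.
Proof. exact: (@rpred0 _ (I : submodClosed S^o)). Qed.

Lemma span2_closed (a b : S) :
  submod_closed ((fun u => `[< exists c d, u = c * a + d * b >]) : {pred S^o}).
Proof.
split=> [|r _ _ /asboolP[c [d ->]] /asboolP[c' [d' ->]]]; apply/asboolP.
  by exists 0, 0; rewrite !mul0r addr0.
exists (r * c + c'), (r * d + d').
by have -> : r *: (c * a + d * b : S^o) = r * (c * a + d * b) by []; ring.
Qed.

Lemma ideal_gen2P (a b u : S) :
  u \in ideal_gen [set a; b] <-> exists c d, u = c * a + d * b.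
Proof.
split=> [|[c [d ->]]].
  move=> /(@ideal_gen_min _ (Submodule (span2_closed a b))) H; apply/asboolP/H.
  by move=> _ [->|->]; apply/asboolP; [exists 1, 0|exists 0, 1];
    rewrite mul1r mul0r ?addr0 ?add0r.
by apply: idealD; apply: idealMl; apply: mem_ideal_gen; [left|right].
Qed.

Lemma ideal_gen1P (a u : S) : u \in ideal_gen [set a] <-> exists c, u = c * a.
Proof.
split=> [|[c ->]]; last by apply: idealMl; apply: mem_ideal_gen.
move=> ua; have [c [d ->]] : exists c d, u = c * a + d * 0.
  by apply/ideal_gen2P; apply: ideal_gen_min ua => _ ->; apply: mem_ideal_gen; left.
by exists c; rewrite mulr0 addr0.
Qed.

(** Raising to the power p^e is additive in characteristic p, so the powers of the two generators
    suffice. Since J is given only up to equality of members, this also applies to an ideal extended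
    to a localization. *)
Lemma frobenius_power_gen2 p e a b J : p \in [pchar S] ->
  J =i ideal_gen [set a ^+ p; b ^+ p] ->
  frobenius_power J (p ^ e) =i ideal_gen [set a ^+ (p * p ^ e); b ^+ (p * p ^ e)].
Proof.
move=> charS JE u; apply/idP/idP.
  apply: ideal_gen_min => _ [z zJ ->]; move: zJ.
  rewrite JE => /ideal_gen2P[c [d ->]]; apply/ideal_gen2P.
  exists (c ^+ (p ^ e)), (d ^+ (p ^ e)).
  rewrite exprDn_pchar; first by rewrite !exprMn -!exprM.
  by rewrite pnatX (pnatE _ (pcharf_prime charS)) charS.
apply: ideal_gen_min => _ [->|->]; rewrite exprM; apply: mem_ideal_gen.
  by exists (a ^+ p); rewrite // JE mem_ideal_gen //; left.
by exists (b ^+ p); rewrite // JE mem_ideal_gen //; right.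
Qed.

Lemma ideal_mulI I J a b : a \in I -> b \in J -> a * b \in ideal_mul I J.
Proof. by move=> aI bJ; apply: mem_ideal_gen; exists a, b. Qed.

Lemma ideal_expI I a n : a \in I -> a ^+ n \in ideal_exp I n.
Proof.
move=> aI; elim: n => [|n IH]; first exact: mem_ideal_gen.
by rewrite exprS; apply: ideal_mulI.
Qed.

End IdealTheory.

(** * Subquotient modules, their associated primes and the length of torsion *)

Section ModuleTheory.
Local Open Scope quotient_scope.
Variable R : comNzRingType.

Lemma subquot_eq (M : lmodType R) (L N : submodule M) (u v : submod_type L) :
  (\pi_(quot_mod (submod_restrict L N)) u = \pi_(quot_mod (submod_restrict L N)) v
     :> subquot L N)
  <-> val u - val v \in N.
Proof.
rewrite -[val u - val v]/(val (u - v)).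
rewrite -[_ \in N]/(u - v \in submod_restrict L N).
by rewrite Quotient.idealrBE; split=> [->|/eqP].
Qed.

Lemma subquot_surj (M : lmodType R) (L N : submodule M) (z : subquot L N) :
  exists u : submod_type L, z = \pi_(quot_mod (submod_restrict L N)) u.
Proof. by exists (repr (z : quot_mod _)); rewrite reprK. Qed.

Lemma subquot_scale (M : lmodType R) (L N : submodule M) a (u : submod_type L) :
  a *: (\pi_(quot_mod (submod_restrict L N)) u : subquot L N)
  = \pi_(quot_mod (submod_restrict L N)) (a *: u).
Proof. exact: quot_scaleE. Qed.

Lemma subquot_eq0 (M : lmodType R) (L N : submodule M) (u : submod_type L) :
  (\pi_(quot_mod (submod_restrict L N)) u = 0 :> subquot L N) <-> val u \in N.
Proof.
rewrite -[X in _ = X](raddf0 \pi_(quot_mod (submod_restrict L N))).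
by rewrite subquot_eq subr0.
Qed.

Lemma associated_prime_subquot (I J P : ideal R) (u : R) :
  is_prime P -> u \in I -> (forall a, a \in P <-> a * u \in J) ->
  associated_prime (subquot I J) P.
Proof.
move=> Pprime uI H; split=> //.
pose v : submod_type I := exist _ u uI.
exists (\pi_(quot_mod (submod_restrict I J)) v) => a.
rewrite subquot_scale.
apply/idP/eqP => [aP|]; first by apply/subquot_eq0; rewrite linearZ /=; apply/H.
by move=> /subquot_eq0; rewrite linearZ => /H.
Qed.

Variable F : realType.

Lemma mod_length_ge0 (M : lmodType R) : (0 <= mod_length F M)%E.
Proof.
apply: ereal_sup_ubound; exists 0%N => //.
by exists (fun=> submod_span [set: M]) => i.
Qed.

(** Every nonzero element generates M, so in a chain with two strict steps the middle submodule
    would have to be zero, against the strictness of the first step. *)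
Lemma mod_length_le1 (M : lmodType R) :
  (forall z z' : M, z' != 0 -> exists a, z = a *: z') ->
  (mod_length F M <= 1)%E.
Proof.
move=> H; apply: ge_ereal_sup => _ [n [C chainC] <-].
rewrite lee_fin lern1; case: n chainC => [|[|n]] // chainC; exfalso.
have [C01 nC10] := chainC 0%N isT; have [C12 nC21] := chainC 1%N isT.
apply: nC10 => z' z'C; have [->|z'0] := eqVneq z' 0; first exact: rpred0.
exfalso; apply: nC21 => z _; have [a ->] := H z z' z'0.
by rewrite rpredZ.
Qed.

(** Torsion classes are represented by multiples c w with c zero or invertible, so a nonzero one
    generates all others. Representatives are compared in R modulo J, hence w may lie outside I. *)
Lemma torsion_length_le1 (I J m : ideal R) (w : R) :
  (forall (u : R) i, (0 < i)%N -> (forall a : R, a \in ideal_exp m i -> a * u \in J) ->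
     exists c, (c = 0 \/ exists d, d * c = 1) /\ u - c * w \in J) ->
  (mod_length F (submod_type (mod_torsion (subquot I J) m)) <= 1)%E.
Proof.
move=> H; apply: mod_length_le1 => z z' z'0.
have lift (y : submod_type (mod_torsion (subquot I J) m)) :
    exists2 u : submod_type I, val y = \pi_(quot_mod (submod_restrict I J)) u &
    exists c, (c = 0 \/ exists d, d * c = 1) /\ val u - c * w \in J.
  have [u uE] := subquot_surj (val y); exists u => //.
  have /asboolP[i i0 Hi] := svalP y; apply: (H _ i i0) => a /Hi.
  by rewrite -/(val y) uE subquot_scale => /subquot_eq0; rewrite linearZ.
have [u zE [c [_ cE]]] := lift z; have [u' z'E [c' [c'1 c'E]]] := lift z'.
have [d dc'] : exists d, d * c' = 1.
  case: c'1 => // c'0; case/eqP: z'0; apply: val_inj; rewrite z'E.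
  by apply/subquot_eq0; move: c'E; rewrite c'0 mul0r subr0.
(* From u = c w, u' = c' w modulo J and d c' = 1 follows u = c d u' modulo J. *)
exists (c * d); apply: val_inj; rewrite linearZ /= -[sval z]/(val z) -[sval z']/(val z').
rewrite zE z'E subquot_scale; apply/subquot_eq.
rewrite linearZ /= -[sval u]/(val u) -[sval u']/(val u').
move: (val u) (val u') cE c'E => v v' cE c'E.
have := idealB cE (idealMl (c * d) c'E).
suff -> : v - c * w - c * d * (v' - c' * w) = v - c * d * v'
  by rewrite scalerN.
have -> : v - c * w - c * d * (v' - c' * w)
  = v - c * w - c * d * v' + c * (d * c') * w by ring.
by rewrite dc'; ring.
Qed.

End ModuleTheory.

(** * Ideals, dimension and torsion in the localization at a prime *)

Section LocalizationTheory.
Variables (R : comNzRingType) (P : ideal R) (P_prime : is_prime P).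
Local Notation L := (localization P_prime).
Local Notation frac := (loc_frac P_prime).
Local Notation loc := (@to_loc R P P_prime).
Local Notation one := (one_denom P_prime).
Local Notation mul := (mul_denom P_prime).

Lemma frac_add a s b t :
  (frac a s + frac b t : L) = frac (a * sval t + b * sval s) (mul s t).
Proof. exact: loc_addE. Qed.

Lemma frac_mul a s b t : (frac a s * frac b t : L) = frac (a * b) (mul s t).
Proof. exact: loc_mulE. Qed.

Lemma frac_opp a s : (- frac a s : L) = frac (- a) s.
Proof. exact: loc_oppE. Qed.

Lemma frac0 s : frac 0 s = 0 :> L.
Proof. by apply: loc_frac_eq => /=; rewrite !mul0r. Qed.

Lemma frac_self a s : a = sval s -> frac a s = 1 :> L.
Proof. by move=> ->; apply: loc_frac_eq => /=; rewrite mul1r mulr1. Qed.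

Lemma to_loc1 : loc 1 = 1. Proof. by []. Qed.

Lemma to_locD a b : loc (a + b) = loc a + loc b.
Proof. by rewrite frac_add; apply: loc_frac_eq; rewrite /= !mulr1. Qed.

Lemma to_locM a b : loc (a * b) = loc a * loc b.
Proof. by rewrite frac_mul; apply: loc_frac_eq; rewrite /= !mulr1. Qed.

Lemma to_locX a n : loc (a ^+ n) = loc a ^+ n.
Proof.
elim: n => [|n IH]; first by rewrite !expr0 to_loc1.
by rewrite !exprS to_locM IH.
Qed.

Lemma to_loc_nat n : loc n%:R = n%:R.
Proof.
elim: n => [|n IH]; first exact: frac0.
by rewrite !mulrS to_locD IH to_loc1.
Qed.

Lemma localization_pchar p : p \in [pchar R] -> p \in [pchar L].
Proof.
by move=> charR; rewrite inE (pcharf_prime charR) -to_loc_nat pcharf0 //=.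
Qed.

Lemma frac_split a s : frac a s = frac 1 s * loc a.
Proof. by rewrite frac_mul; apply: loc_frac_eq; rewrite /= mul1r mulr1. Qed.

(** Passing to a common denominator keeps the numerator in I; therefore these fractions exhaust the
    extended ideal, as [ideal_extP] records. *)
Lemma frac_ideal_closed (I : ideal R) :
  submod_closed ((fun z => `[< exists a s, a \in I /\ z = frac a s >]) : {pred L^o}).
Proof.
split=> [|r z w]; first by apply/asboolP; exists 0, one; rewrite ideal0 frac0.
move=> /asboolP[a [s [aI ->]]] /asboolP[b [t [bI ->]]]; apply/asboolP.
elim/loc_fracW: r => c u.
exists (c * a * sval t + b * (sval u * sval s)), (mul (mul u s) t); split.
  by apply: idealD; [rewrite mulrAC; apply: idealMl|rewrite mulrC; apply: idealMl].
have -> : (frac c u : L) *: (frac a s : L^o) = frac c u * frac a s by [].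
by rewrite frac_mul frac_add.
Qed.

Lemma ideal_extP (I : ideal R) z :
  z \in ideal_ext loc I <-> exists a s, a \in I /\ z = frac a s.
Proof.
split=> [|[a [s [aI ->]]]].
  move=> /(@ideal_gen_min _ _ (Submodule (frac_ideal_closed I))) H; apply/asboolP/H.
  by move=> _ [a aI ->]; apply/asboolP; exists a, one.
by rewrite frac_split; apply: idealMl; apply: mem_ideal_gen; exists a.
Qed.

Lemma ideal_ext_gen2 (a b : R) :
  ideal_ext loc (ideal_gen [set a; b]) =i ideal_gen [set loc a; loc b].
Proof.
move=> z; apply/idP/idP.
  apply: ideal_gen_min => _ [c /ideal_gen2P[d [e ->]] ->]; apply/ideal_gen2P.
  by exists (loc d), (loc e); rewrite to_locD !to_locM.
apply: ideal_gen_min => _ [->|->]; apply: mem_ideal_gen.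
  by exists a => //; apply: mem_ideal_gen; left.
by exists b => //; apply: mem_ideal_gen; right.
Qed.

Section ExtendedPrime.
Variable Q : ideal R.
Hypotheses (Q_prime : is_prime Q) (QP : {subset Q <= P}).

Lemma prime_notin_mul a (w : loc_denom P) : sval w * a \in Q -> a \in Q.
Proof.
move=> /Q_prime.2 /orP[/QP|//].
by rewrite (negPf (svalP w)).
Qed.

(** Denominators lie outside P, hence outside the smaller prime Q, and can be cancelled from a
    product lying in Q. *)
Lemma frac_ideal_ext a s : (frac a s \in ideal_ext loc Q) = (a \in Q).
Proof.
apply/idP/idP => [/ideal_extP[b [t [bQ]]]|aQ]; last by apply/ideal_extP; exists a, s.
move=> /loc_fracP[w E]; apply: (@prime_notin_mul _ t); apply: (@prime_notin_mul _ w).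
by rewrite [sval t * a]mulrC E mulrA mulrAC; apply: idealMl.
Qed.

Lemma ideal_ext_prime : is_prime (ideal_ext loc Q).
Proof.
split; first by rewrite -to_loc1 frac_ideal_ext Q_prime.1.
move=> u v; elim/loc_fracW: u => a s; elim/loc_fracW: v => b t.
by rewrite frac_mul !frac_ideal_ext; apply: Q_prime.2.
Qed.

End ExtendedPrime.

(** Extension keeps Q and P prime, and [frac_ideal_ext] recovers them, so the chain of the two
    extensions stays strict. *)
Lemma krull_dim_localization_ge1 (F : realType) (Q : ideal R) :
  is_prime Q -> {subset Q <= P} -> ~ {subset P <= Q} ->
  (1 <= krull_dim F L)%E.
Proof.
move=> Qp QP nPQ; apply: ereal_sup_ubound; exists 1%N => //.
exists (fun i => if i == 0%N then ideal_ext loc Q else ideal_ext loc P); split.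
  by move=> [|i] _ /=; apply: ideal_ext_prime.
move=> [|i] //= _; split.
  by elim/loc_fracW=> a s; rewrite !frac_ideal_ext //; apply: QP.
move=> H; apply: nPQ => a aP.
by have := H (loc a); rewrite !frac_ideal_ext //; apply.
Qed.

(** Clearing denominators brings a torsion fraction back to an element of R with a t-power multiple
    in J, so the analysis of t-power torsion in R also settles the localization. *)
Lemma localization_torsion_length_le1 (F : realType) (I' J' : ideal L)
    (J m : ideal R) (t w : R) :
  t \in m -> J' =i ideal_ext loc J ->
  (forall u i, t ^+ i * u \in J ->
     exists c, (c = 0 \/ exists d, d * c = 1) /\ u - c * w \in J) ->
  (mod_length F (submod_type (mod_torsion (subquot I' J') (ideal_ext loc m))) <= 1)%E.
Proof.
move=> tm J'E H; apply: (@torsion_length_le1 _ F I' J' _ (loc w)) => u i _ tors.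
have /tors : loc t ^+ i \in ideal_exp (ideal_ext loc m) i.
  by apply: ideal_expI; apply: mem_ideal_gen; exists t.
elim/loc_fracW: u tors => v d _.
rewrite J'E -to_locX frac_mul => /ideal_extP[a [e [aJ /loc_fracP[f /= E]]]].
(* The fraction v/d equals f e v over D = f e d, and the factor f e moves t^i v into J itself. *)
have [|c [c1 cE]] := H (sval f * sval e * v) i.
  have -> : t ^+ i * (sval f * sval e * v) = sval f * (t ^+ i * v * sval e) by ring.
  by rewrite E mulrCA mulrC; apply: idealMl.
pose D := mul (mul f e) d.
exists (frac c D); split.
  case: c1 => [->|[c' c'c]]; [left; exact: frac0|right].
  exists (loc (c' * sval D)); rewrite frac_mul; apply: frac_self => /=.
  by rewrite mulrAC c'c mul1r.
rewrite J'E; apply/ideal_extP; exists (sval f * sval e * v - c * w), D; split=> //.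
rewrite frac_mul frac_opp frac_add; apply: loc_frac_eq => /=; ring.
Qed.

End LocalizationTheory.

(** * Vanishing of the relative multiplicity for bounded torsion length *)

Section RelativeMultiplicityBound.
Variable F : realType.

(** As q^d is at least q once d is at least 1, a lower bound on the dimension suffices and its exact
    value is never computed. *)
Lemma div_pow_dim_le (l d : \bar F) (q : nat) : (0 < q)%N ->
  (0 <= l <= 1 -> 1 <= d -> 0 <= l / pow_dim q d <= (q%:R^-1)%:E)%E.
Proof.
move=> q0 /andP[l0 l1]; case: d => [r| |] //=.
  rewrite lee_fin => r1.
  have q1 : (1 : F) <= q%:R by rewrite ler1n.
  have qr : (q%:R : F) <= q%:R `^ r by rewrite -{1}[q%:R]powRr1 ?ler_powR.
  have qr0 : (0 : F) < q%:R `^ r by apply: lt_le_trans qr; rewrite ltr0n.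
  rewrite inver gt_eqF //; apply/andP; split.
    by rewrite mule_ge0 // lee_fin invr_ge0 ltW.
  rewrite lee_pdivrMr // (le_trans l1) // -EFinM lee_fin.
  by rewrite mulrC ler_pdivlMr ?ltr0n // mul1r.
(* For infinite d the divisor is infinite and its inverse is 0. *)
by move=> _; rewrite invey mule0 lexx lee_fin invr_ge0 ler0n.
Qed.

Lemma rel_mult_is0 (p : nat) (S : comNzRingType) (n J I : ideal S) :
  (1 < p)%N -> (1 <= krull_dim F S)%E ->
  (forall e, (mod_length F (submod_type (mod_torsion
     (subquot (frobenius_power I (p ^ e)) (frobenius_power J (p ^ e))) n)) <= 1)%E) ->
  rel_mult_is p n J I (0%E : \bar F).
Proof.
move=> p1 dim1 len1.
suff : rel_mult_seq F p n J I @ \oo --> (0%E : \bar F).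
  by move=> /cvg_limn_einf_sup[]; split.
apply: (@squeeze_cvge _ _ _ _ (fun=> 0%E) _ (fun e => ((p%:R^-1 : F) ^+ e)%:E)).
- apply: nearW => e; rewrite exprVn -natrX; apply: div_pow_dim_le => //.
    by rewrite expn_gt0 (ltnW p1).
  by rewrite mod_length_ge0 len1.
- exact: cvg_cst.
- apply/cvg_EFin; first exact: nearW.
  apply: cvg_expr; rewrite ger0_norm ?invr_ge0 ?ler0n //.
  by rewrite invf_lt1 ?ltr0n ?ltr1n // ltnW.
Qed.

End RelativeMultiplicityBound.

(** * Divisibility by powers of a variable and membership in (x^N, y^N, f) *)

Lemma polyC_mul_dvdXn (D : idomainType) (b : D) (v w : {poly D}) n :
  b != 0 -> b%:P * v = w * 'X^n -> exists v', v = v' * 'X^n.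
Proof.
move=> b0 E; exists (drop_poly n v); rewrite -{1}(poly_take_drop n v).
(* In a domain, a coefficient of v vanishes as soon as its product with b does. *)
suff -> : take_poly n v = 0 by rewrite add0r.
apply/polyP => i; rewrite coef_take_poly coef0; case: ltnP => // lt_in.
have := congr1 (fun u : {poly D} => u`_i) E.
rewrite coefCM coefMXn lt_in => /eqP.
by rewrite mulf_eq0 (negPf b0) => /eqP.
Qed.

Section MembershipModPowers.
Variables (S : comNzRingType) (x y f : S).

(** Over the polynomial ring this is the preimage of the ideal (x^N, y^N) of the quotient by f.
    Explicit coefficients turn membership into an identity that can be evaluated; f is a parameter
    because g takes its place below. *)
Definition in_xy N (u : S) :=
  exists a b c, u = a * x ^+ N + b * y ^+ N + c * f.

Lemma in_xyD N u v : in_xy N u -> in_xy N v -> in_xy N (u + v).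
Proof.
move=> [a [b [c ->]]] [a' [b' [c' ->]]].
by exists (a + a'), (b + b'), (c + c'); ring.
Qed.

Lemma in_xyMl N u v : in_xy N v -> in_xy N (u * v).
Proof.
move=> [a [b [c ->]]].
by exists (u * a), (u * b), (u * c); ring.
Qed.

Lemma in_xyB N u v : in_xy N u -> in_xy N v -> in_xy N (u - v).
Proof. by move=> Ju Jv; rewrite -mulN1r; apply: in_xyD (in_xyMl _ Jv). Qed.

End MembershipModPowers.

(** * Restriction to the four lines of f = 0, and torsion over k[s] *)

Section PlaneEvaluation.
Variable k : fieldType.
Notation B := {poly k}.
Notation A := {poly {poly {poly k}}}.
Local Notation s := (pol_s k).
Local Notation x := (pol_x k).
Local Notation y := (pol_y k).

(** [scal] embeds k[s]. A one-variable polynomial over k[s] is placed in the variable y by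
    [poly_in_y], and in the variable x by [%:P]. *)
Definition scal (b : B) : A := b%:P%:P.
Definition poly_in_y (a : {poly B}) : A := map_poly polyC a.

Lemma scal1 : scal 1 = 1. Proof. by []. Qed.
Lemma scalD b c : scal (b + c) = scal b + scal c.
Proof. by rewrite /scal !polyCD. Qed.
Lemma scalN b : scal (- b) = - scal b.
Proof. by rewrite /scal !polyCN. Qed.
Lemma scalM b c : scal (b * c) = scal b * scal c.
Proof. by rewrite /scal !polyCM. Qed.
Lemma scalX b n : scal (b ^+ n) = scal b ^+ n.
Proof. by rewrite /scal !polyC_exp. Qed.
Lemma scal_mulVf (c : k) : c != 0 -> scal (c^-1)%:P * scal c%:P = 1.
Proof. by move=> c0; rewrite -scalM -polyCM (mulVf c0) polyC1 scal1. Qed.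

Lemma pol_sE : s = scal 'X. Proof. by []. Qed.

Lemma poly_in_y0 : poly_in_y 0 = 0.
Proof. exact: rmorph0. Qed.
Lemma poly_in_yD a b : poly_in_y (a + b) = poly_in_y a + poly_in_y b.
Proof. exact: rmorphD. Qed.
Lemma poly_in_yN a : poly_in_y (- a) = - poly_in_y a.
Proof. exact: rmorphN. Qed.
Lemma poly_in_yM a b : poly_in_y (a * b) = poly_in_y a * poly_in_y b.
Proof. exact: rmorphM. Qed.
Lemma poly_in_yX n : poly_in_y 'X^n = y ^+ n.
Proof. by rewrite /poly_in_y rmorphXn /= map_polyX. Qed.
Lemma poly_in_yC b : poly_in_y b%:P = scal b.
Proof. by rewrite /poly_in_y map_polyC. Qed.

Definition poly_in_yE :=
  (poly_in_y0, poly_in_yC, poly_in_yX 1, poly_in_yX, poly_in_yN, poly_in_yD, poly_in_yM).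

(** The k[s]-algebra map to k[s][t] with x sent to X and y to Y. In the target ['X] is t, while s is
    ['X%:P]. *)
Definition plane_eval (X Y : {poly B}) (u : A) : {poly B} :=
  (map_poly (comp_poly X) u).[Y].

Section Morphism.
Variables X Y : {poly B}.
Implicit Types u v : A.

Lemma plane_evalD u v : plane_eval X Y (u + v) = plane_eval X Y u + plane_eval X Y v.
Proof. by rewrite /plane_eval rmorphD hornerD. Qed.

Lemma plane_evalN u : plane_eval X Y (- u) = - plane_eval X Y u.
Proof. by rewrite /plane_eval rmorphN hornerN. Qed.

Lemma plane_evalM u v : plane_eval X Y (u * v) = plane_eval X Y u * plane_eval X Y v.
Proof. by rewrite /plane_eval rmorphM hornerM. Qed.

Lemma plane_evalXn u n : plane_eval X Y (u ^+ n) = plane_eval X Y u ^+ n.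
Proof. by rewrite /plane_eval rmorphXn horner_exp. Qed.

Lemma plane_eval_x : plane_eval X Y x = X.
Proof. by rewrite /plane_eval map_polyC hornerC /= comp_polyX. Qed.

Lemma plane_eval_y : plane_eval X Y y = Y.
Proof. by rewrite /plane_eval map_polyX hornerX. Qed.

Lemma plane_eval_scal b : plane_eval X Y (scal b) = b%:P.
Proof. by rewrite /plane_eval map_polyC hornerC /= comp_polyC. Qed.

Lemma plane_eval_poly_in_y a : plane_eval X Y (poly_in_y a) = a \Po Y.
Proof.
rewrite /plane_eval /poly_in_y -map_poly_comp /comp_poly; congr (_.[_]).
by apply: eq_map_poly => c /=; rewrite comp_polyC.
Qed.

Lemma plane_eval_polyC (a : {poly B}) : plane_eval X Y a%:P = a \Po X.
Proof. by rewrite /plane_eval map_polyC hornerC. Qed.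

End Morphism.

Lemma plane_split (u : A) :
  exists v P Q, u = x * y * v + x * P%:P + poly_in_y Q.
Proof.
elim/poly_ind: u => [|u c [v [P [Q ->]]]].
  by exists 0, 0, 0; rewrite polyC0 poly_in_y0 !mulr0 !addr0.
have [h ->] := poly_split c.
exists (y * v + P%:P), h, (Q * 'X + (c.[0])%:P).
rewrite !polyCD polyCM !poly_in_yE /scal -/x -/y; ring.
Qed.

Definition pol_g : A := (x - y) * (x - (s - 1) * y).
Local Notation g := pol_g.

Lemma pol_fE : pol_f k = x * y * g.
Proof. by rewrite /pol_f /pol_g; ring. Qed.

(** This is division by g, monic of degree 2 in x. Since y is the outer variable of the
    representation, it is carried out by induction on both variables. *)
Lemma linear_mod_g (u : A) : exists a b c, u = poly_in_y a + poly_in_y b * x + c * g.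
Proof.
elim/poly_ind: u => [|u d [a [b [c ->]]]].
  by exists 0, 0, 0; rewrite !poly_in_y0 !mul0r !addr0.
have [a1 [b1 [c1 ->]]] : exists a b c,
    d%:P = poly_in_y a + poly_in_y b * x + c * g.
  elim/poly_ind: d => [|d e [a1 [b1 [c1 dE]]]].
    by exists 0, 0, 0; rewrite !poly_in_y0 !mul0r !addr0.
  (* Multiplication by x uses x^2 = s x y - (s - 1) y^2 + g. *)
  exists (e%:P - ('X - 1)%:P * 'X^2 * b1), (a1 + 'X%:P * 'X * b1), (c1 * x + poly_in_y b1).
  rewrite polyCD polyCM dE !poly_in_yE scalD scalN scal1 -(pol_sE) -/x -/(scal e) /pol_g.
  by ring.
exists ('X * a + a1), ('X * b + b1), (y * c + c1).
by rewrite !poly_in_yE -/y; ring.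
Qed.

Lemma plane_eval_g1 : plane_eval 'X 'X g = 0.
Proof. by rewrite plane_evalM plane_evalD plane_evalN plane_eval_x plane_eval_y subrr mul0r. Qed.

Lemma plane_eval_g2 : plane_eval (('X - 1)%:P * 'X) 'X g = 0.
Proof.
rewrite plane_evalM; apply/eqP; rewrite mulf_eq0; apply/orP; right.
rewrite plane_evalD plane_evalN plane_evalM plane_eval_x plane_eval_y.
by rewrite pol_sE -scal1 -scalN -scalD plane_eval_scal subrr.
Qed.

Lemma plane_eval_f_x0 : plane_eval 0 'X (pol_f k) = 0.
Proof. by rewrite pol_fE -mulrA plane_evalM plane_eval_x mul0r. Qed.

Lemma plane_eval_f_y0 : plane_eval 'X 0 (pol_f k) = 0.
Proof. by rewrite pol_fE mulrAC mulrC plane_evalM plane_eval_y mul0r. Qed.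

Local Notation in_xyf := (in_xy x y (pol_f k)).
Local Notation in_xyg := (in_xy x y g).

Lemma plane_eval_xy a b c h X Y N : plane_eval X Y h = 0 ->
  plane_eval X Y (a * x ^+ N + b * y ^+ N + c * h) =
  plane_eval X Y a * X ^+ N + plane_eval X Y b * Y ^+ N.
Proof.
move=> h0; rewrite 2!plane_evalD 3!plane_evalM 2!plane_evalXn.
by rewrite plane_eval_x plane_eval_y h0 mulr0 addr0.
Qed.

Lemma pol_x_neq0 : x != 0. Proof. by rewrite polyC_eq0 polyX_eq0. Qed.
Lemma pol_y_neq0 : y != 0. Proof. by rewrite polyX_eq0. Qed.

Lemma plane_eval_y0 u : plane_eval 'X 0 u = u.[0].
Proof.
by rewrite /plane_eval map_poly_id // => c _; rewrite /= comp_polyXr.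
Qed.

(** Restricting to y = 0 shows that y divides the coefficient of x^(N+1), and restricting to x = 0
    that x divides that of y^(N+1). Then xy cancels. *)
Lemma in_xyf_strip N v : in_xyf N.+1 (x * y * v) -> in_xyg N v.
Proof.
move=> [a [b [c E]]].
have a0 : a.[0] = 0.
  have := congr1 (plane_eval 'X 0) E.
  rewrite (plane_eval_xy _ _ _ _ plane_eval_f_y0) 2!plane_evalM plane_eval_y.
  rewrite [0 ^+ _]exprS !(mul0r, mulr0) addr0 => /esym/eqP.
  by rewrite mulf_eq0 expf_eq0 polyX_eq0 orbF plane_eval_y0 => /eqP.
have [a' aE] := poly_split a; rewrite a0 polyC0 addr0 -/y in aE.
have [b' bE] : exists b', b = b' * x.
  have [v1 [P [Q bE]]] := plane_split b.
  exists (y * v1 + P%:P); suff Q0 : Q = 0 by rewrite bE Q0 poly_in_y0; ring.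
  have := congr1 (plane_eval 0 'X) E.
  rewrite (plane_eval_xy _ _ _ _ plane_eval_f_x0) 2!plane_evalM plane_eval_x.
  rewrite [0 ^+ _]exprS !(mul0r, mulr0) add0r => /esym/eqP.
  rewrite mulf_eq0 expf_eq0 polyX_eq0 orbF bE 2!plane_evalD 3!plane_evalM.
  rewrite plane_eval_x !mul0r !add0r.
  by rewrite plane_eval_poly_in_y comp_polyXr => /eqP.
exists a', b', c; apply: (mulfI (mulf_neq0 pol_x_neq0 pol_y_neq0)).
rewrite E aE bE pol_fE !exprS -/y; ring.
Qed.

(** Write v = a1(y) + b1(y) x modulo g. On the lines (t, t) and ((s - 1)t, t) both values are
    divisible by t^(N+1), also after removal of b; these two linear conditions determine a1 and
    b1. *)
Lemma xyg_torsion N (b : B) v :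
  b != 0 -> in_xyg N.+1 (scal b * v) ->
  exists d, in_xyg N.+1 (v - scal d * x * y ^+ N).
Proof.
move=> b0 [al [be [ga E]]].
have [a1 [b1 [c vE]]] := linear_mod_g v.
have := congr1 (plane_eval 'X 'X) E.
rewrite (plane_eval_xy _ _ _ _ plane_eval_g1) plane_evalM plane_eval_scal.
rewrite -mulrDl => /(polyC_mul_dvdXn b0)[V1].
have := congr1 (plane_eval (('X - 1)%:P * 'X) 'X) E.
rewrite (plane_eval_xy _ _ _ _ plane_eval_g2) plane_evalM plane_eval_scal.
rewrite exprMn mulrA -mulrDl => /(polyC_mul_dvdXn b0)[V2].
rewrite vE 2![in X in X -> _]plane_evalD 2![in X in X -> _]plane_evalM plane_eval_g2 => E2.
rewrite 2!plane_evalD 2!plane_evalM plane_eval_g1.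
move: E2; rewrite !mulr0 !addr0.
rewrite !plane_eval_poly_in_y !comp_polyXr !plane_eval_x => E2 E1.
(* Here s - 2 is the difference of the slopes s - 1 and 1; subtracting the two values isolates
   b1. *)
have r0 : ('X - 2%:P : B) != 0 by exact: monic_neq0 (monicXsubC _).
have [W WE] : exists W : {poly B}, b1 * 'X = W * 'X^(N.+1).
  apply: (polyC_mul_dvdXn r0 (w := V2 - V1)).
  rewrite mulrBl -E1 -E2 !polyCB !polyC1.
  have -> : (2%:P%:P : {poly B}) = 1 + 1 by rewrite -!polyCD.
  by ring.
have b1E : b1 = W * 'X^N.
  have X0 : ('X : {poly B}) != 0 by rewrite polyX_eq0.
  by apply: (mulIf X0); rewrite WE exprS; ring.
have a1E : a1 = (V1 - W) * 'X^(N.+1) by rewrite mulrBl -E1 WE addrK.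
(* Only the constant term of W survives: the rest of W(y) x y^N is a multiple of y^(N+1). *)
have [W' W'E] := poly_split W.
exists W.[0], 0, (poly_in_y (V1 - W) + poly_in_y W' * x), c.
rewrite a1E b1E [in poly_in_y (W * _)]W'E !poly_in_yE.
rewrite !exprS -/y; ring.
Qed.

Lemma in_xyg_xy N v : in_xyg N v -> in_xyf N.+1 (x * y * v).
Proof.
move=> [a [b [c ->]]].
by exists (a * y), (b * x), c; rewrite pol_fE !exprS; ring.
Qed.

(** The lines x = 0 and y = 0 show that the part of u prime to xy already lies in the ideal; the
    part xy v is treated by removing xy and applying [xyg_torsion]. *)
Lemma in_xyf_torsion N (b : B) u :
  b != 0 -> in_xyf N.+2 (scal b * u) ->
  exists d, in_xyf N.+2 (u - scal d * (x ^+ 2 * y ^+ N.+1)).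
Proof.
move=> b0 Ju.
have [a1 [b1 [c1 E]]] := Ju.
have [v [P [Q uE]]] := plane_split u.
have [Q' QE] : exists Q' : {poly B}, Q = Q' * 'X^(N.+2).
  apply: (polyC_mul_dvdXn b0 (w := plane_eval 0 'X b1)).
  have := congr1 (plane_eval 0 'X) E.
  rewrite (plane_eval_xy _ _ _ _ plane_eval_f_x0) plane_evalM plane_eval_scal.
  rewrite [0 ^+ _]exprS mul0r mulr0 add0r => <-; congr (_ * _).
  rewrite uE 2!plane_evalD 3!plane_evalM plane_eval_x !mul0r !add0r.
  by rewrite plane_eval_poly_in_y comp_polyXr.
(* On y = 0 the y-part contributes Q(0), which is 0 because Q is a multiple of t^(N+2). *)
have [P' PE] : exists P' : {poly B}, P * 'X = P' * 'X^(N.+2).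
  apply: (polyC_mul_dvdXn b0 (w := plane_eval 'X 0 a1)).
  have := congr1 (plane_eval 'X 0) E.
  rewrite (plane_eval_xy _ _ _ _ plane_eval_f_y0) plane_evalM plane_eval_scal.
  rewrite [0 ^+ _]exprS mul0r mulr0 addr0 => <-; congr (_ * _).
  rewrite uE 2!plane_evalD 3!plane_evalM plane_eval_x plane_eval_y mulr0 mul0r add0r.
  rewrite plane_eval_polyC comp_polyXr plane_eval_poly_in_y QE comp_polyM.
  by rewrite comp_Xn_poly exprS mul0r mulr0 addr0 mulrC.
have P'E : x * P%:P = P'%:P * x ^+ N.+2.
  by rewrite /pol_x mulrC -polyCM PE polyCM polyC_exp.
have Juv : in_xyf N.+2 (u - x * y * v).
  exists P'%:P, (poly_in_y Q'), 0.
  rewrite uE P'E QE !poly_in_yE; ring.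
have := in_xyB Ju (in_xyMl (scal b) Juv).
have -> : scal b * u - scal b * (u - x * y * v) = x * y * (scal b * v) by ring.
move=> /in_xyf_strip /(xyg_torsion b0)[d /in_xyg_xy Jd]; exists d.
have := in_xyD Juv Jd; congr in_xy; rewrite !exprS; ring.
Qed.

End PlaneEvaluation.

(** * Relations satisfied by w and by monomials of the same degree *)

Section SocleRelations.
Variables (S : comNzRingType) (s x y f : S).
Let g := (x - y) * (x - (s - 1) * y).
Hypothesis fE : f = x * y * g.

Lemma x_power_mod_g i :
  exists a b c, x ^+ i.+1 = a * x * y ^+ i + b * y ^+ i.+1 + c * g.
Proof.
elim: i => [|i [a [b [c IH]]]].
  by exists 1, 0, 0; rewrite !mul0r !addr0 mul1r expr0 mulr1 expr1.
exists (a * s + b), (- (a * (s - 1))), (c * x + a * y ^+ i).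
by rewrite exprS IH !exprS /g; ring.
Qed.

(** The right side is the Lagrange interpolant of x^(i+1) at the roots x = y and x = (s - 1)y of g;
    the factor s - 2 clears its denominator. *)
Lemma x_power_mod_g_roots i :
  exists c, (s - 1 - 1) * x ^+ i.+1 =
    y ^+ i * (((s - 1) ^+ i.+1 - 1) * x - ((s - 1) ^+ i.+1 - (s - 1)) * y) + c * g.
Proof.
elim: i => [|i [c IH]]; first by exists 0; rewrite !exprS !expr0; ring.
exists (c * x + y ^+ i * ((s - 1) ^+ i.+1 - 1)).
rewrite exprS mulrCA IH !exprS /g.
move: ((s - 1) ^+ i) (y ^+ i) => ri yi; ring.
Qed.

(* The exponent pq of the introduction is [N.+2] from here on. *)
Variable N : nat.
Definition socle_w : S := x ^+ 2 * y ^+ N.+1.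
Local Notation w := socle_w.
Local Notation J := (in_xy x y f N.+2).

Lemma in_xy_xw : J (x * w).
Proof.
(* The product y^N f is x^3 y^(N+1) plus terms divisible by y^(N+2). *)
exists 0, (s * x ^+ 2 - (s - 1) * (x * y)), (y ^+ N).
by rewrite fE /socle_w /g !exprS; ring.
Qed.

Lemma in_xy_yw : J (y * w).
Proof. by exists 0, (x ^+ 2), 0; rewrite /socle_w !exprS; ring. Qed.

(** After xy is split off, x^(a+1) reduces modulo g to a combination of x y^a and y^(a+1); the
    second gives a multiple of y^(N+2). *)
Lemma in_xy_monomial_w a b : (a + b)%N = N ->
  exists c, J (x ^+ a.+2 * y ^+ b.+1 - c * w).
Proof.
move=> abN; have [a1 [b1 [c1 E]]] := x_power_mod_g a.
exists a1, 0, (b1 * x), (c1 * y ^+ b).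
have -> : x ^+ a.+2 * y ^+ b.+1 = x * y * x ^+ a.+1 * y ^+ b.
  by rewrite !exprS; ring.
by rewrite E fE /socle_w -abN !exprS exprD; ring.
Qed.

Hypothesis frobenius_s1 : (s - 1) ^+ N.+2 = s ^+ N.+2 - 1.

(** Put r = s - 1. The interpolation formula for x^(N+1), multiplied by r x y, has a multiple of
    x^(N+2) on the left and (r^(N+2) - r) w modulo y^(N+2) on the right; Frobenius turns r^(N+2) - r
    into s^(N+2) - s. *)
Lemma in_xy_sw : J ((s ^+ N.+2 - s) * w).
Proof.
have -> : s ^+ N.+2 - s = (s - 1) ^+ N.+2 - (s - 1) by rewrite frobenius_s1; ring.
have [c E] := x_power_mod_g_roots N.
exists ((s - 1) * (s - 1 - 1) * y), ((s - 1) * ((s - 1) ^+ N.+1 - (s - 1)) * x).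
exists (- ((s - 1) * c)).
have -> : (s - 1) * (s - 1 - 1) * y * x ^+ N.+2
  = (s - 1) * x * y * ((s - 1 - 1) * x ^+ N.+1) by rewrite exprS; ring.
rewrite E fE /socle_w !exprS.
move: ((s - 1) ^+ N) (y ^+ N) => rN yN; ring.
Qed.

Lemma in_xy_sw_power j : J ((s ^+ (j * N.+1).+1 - s) * w).
Proof.
elim: j => [|j IH]; first by exists 0, 0, 0; rewrite mul0n expr1; ring.
have := in_xyD IH (in_xyMl (s ^+ (j * N.+1)) in_xy_sw); congr in_xy.
rewrite mulSn addnC -addSn exprD !exprS.
move: (s ^+ N) (s ^+ (j * N.+1)) => u v; ring.
Qed.

Definition socle_gen : S := (s ^+ N.+1 - 1) * w.

Lemma in_xy_s_socle_gen : J (s * socle_gen).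
Proof.
by have := in_xy_sw; congr in_xy; rewrite /socle_gen !exprS; ring.
Qed.

(** Multiplication by s^(i(N+1)) fixes s d w modulo J, and s^(i(N+1)+1) contains the factor s^i that
    kills d w. *)
Lemma in_xy_s_torsion_w i u d :
  J (s ^+ i * u) -> J (u - d * w) -> J (s * (d * w)).
Proof.
move=> Ju Jd.
have J1 := in_xyB (in_xyMl (s ^+ (i * N).+1) Ju)
    (in_xyMl (s ^+ (i * N).+1 * s ^+ i) Jd).
have := in_xyB J1 (in_xyMl d (in_xy_sw_power i)).
congr in_xy; rewrite mulnS addnC !exprS exprD.
move: (s ^+ _) (s ^+ i) => a b; ring.
Qed.

(** With d = h s + d0 and s d w in J, u is d w = -(s^(N+1) - 1) d w modulo J. As s kills
    [socle_gen], only -d0 times it remains. *)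
Lemma in_xy_socle_gen_multiple u h d0 :
  J (u - (h * s + d0) * w) -> J (s * ((h * s + d0) * w)) ->
  J (u + d0 * socle_gen).
Proof.
move=> Jd Jsd.
have := in_xyB (in_xyD Jd (in_xyMl (s ^+ N) Jsd)) (in_xyMl h in_xy_s_socle_gen).
by congr in_xy; rewrite /socle_gen exprS; ring.
Qed.

Lemma in_xy_multiple_w u v c :
  J (v - c * w) -> J (u * w) -> J (u * v).
Proof.
move=> Jv Jw; have := in_xyD (in_xyMl u Jv) (in_xyMl c Jw).
by congr in_xy; ring.
Qed.

Variables a b : nat.
Hypothesis abN : (a + b)%N = N.

Lemma in_xy_sN_monomial : J ((s ^+ N.+2 - s) * (x ^+ a.+2 * y ^+ b.+1)).
Proof.
have [c Jc] := in_xy_monomial_w abN.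
exact: in_xy_multiple_w Jc in_xy_sw.
Qed.

Local Notation z := ((s ^+ N.+1 - 1) * (x ^+ a.+2 * y ^+ b.+1)).

(** The monomial is a multiple of w modulo J, so z inherits what kills [socle_gen]. *)
Lemma in_xy_killed_monomial : [/\ J (s * z), J (x * z) & J (y * z)].
Proof.
have [c Jc] := in_xy_monomial_w abN.
have Jk u : J (u * (s ^+ N.+1 - 1) * w) -> J (u * z).
  by move=> Ju; rewrite mulrA; apply: in_xy_multiple_w Jc Ju.
split; apply: Jk.
- by rewrite mulrBr mulr1 -exprS; apply: in_xy_sw.
- by rewrite [x * _]mulrC -mulrA; apply/in_xyMl/in_xy_xw.
- by rewrite [y * _]mulrC -mulrA; apply/in_xyMl/in_xy_yw.
Qed.

End SocleRelations.

(** * The s-power torsion, and monomials that stay outside the ideal *)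

Section SocleGenerator.
Variable k : fieldType.
Notation B := {poly k}.
Notation A := {poly {poly {poly k}}}.
Local Notation s := (pol_s k).
Local Notation x := (pol_x k).
Local Notation y := (pol_y k).
Local Notation g := (pol_g k).
Variable N : nat.
Local Notation J := (in_xy x y (pol_f k) N.+2).
Hypothesis frobenius_s1 : ('X - 1) ^+ N.+2 = 'X ^+ N.+2 - 1 :> B.

Lemma frobenius_s : (s - 1) ^+ N.+2 = s ^+ N.+2 - 1 :> A.
Proof.
by rewrite pol_sE -scal1 -scalN -scalD -!scalX frobenius_s1 scalD scalN.
Qed.

(** As s^i is a nonzero element of k[s], u is some d w modulo J; s-power torsion then leaves only
    the value of d at s = 0. *)
Lemma in_xyf_s_torsion i u : J (s ^+ i * u) ->
  exists c : k, J (u - scal c%:P * socle_gen s x y N).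
Proof.
move=> Ju.
have Xi0 : 'X^i != 0 :> B by rewrite expf_neq0 // polyX_eq0.
have [d Jd] : exists d, J (u - scal d * socle_w x y N).
  by apply: in_xyf_torsion Xi0 _; rewrite scalX.
have Jsd := in_xy_s_torsion_w (pol_fE k) frobenius_s Ju Jd.
have [h dE] := poly_split d.
have {}dE : scal d = scal h * s + scal (d.[0])%:P by rewrite pol_sE -scalM -scalD -dE.
exists (- d.[0]); rewrite polyCN scalN mulNr opprK.
by apply: (in_xy_socle_gen_multiple (pol_fE k) frobenius_s (h := scal h)); rewrite -dE.
Qed.

(** One degree below w there is no torsion: after removal of xy, the restriction to (t, t) is h t^N,
    which would be a multiple of t^(N+1). *)
Lemma in_xyf_monomial_torsion_free h a b : (a + b)%N = N ->
  J (scal h * (x ^+ a.+1 * y ^+ b.+1)) -> h = 0.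
Proof.
move=> abN.
have -> : scal h * (x ^+ a.+1 * y ^+ b.+1) = x * y * (scal h * (x ^+ a * y ^+ b)).
  by rewrite !exprS; ring.
move=> /in_xyf_strip[a1 [b1 [c1 E]]].
have := congr1 (plane_eval 'X 'X) E.
rewrite (plane_eval_xy _ _ _ _ (plane_eval_g1 k)) 2!plane_evalM 2!plane_evalXn.
rewrite plane_eval_x plane_eval_y plane_eval_scal -exprD abN -mulrDl.
move=> /(congr1 (fun v : {poly B} => v`_N)).
by rewrite coefCM coefXn eqxx mulr1 coefMXn ltnSn.
Qed.

Lemma plane_eval_00 X Y u : X.[0] = 0 -> Y.[0] = 0 ->
  (@plane_eval k X Y u).[0] = u.[0].[0].
Proof.
move=> X0 Y0; have [h hE] := poly_split u.
rewrite {1}hE -/y plane_evalD plane_evalM plane_eval_y plane_eval_polyC.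
by rewrite hornerD hornerM Y0 mulr0 add0r horner_comp X0.
Qed.

(** Membership, restricted to (t, t) and (rt, t) with r = s - 1 and read at t = 0 after cancelling
    t^(N+1), gives E = a0 + b0 and r^(a+1) E = r^(N+1) a0 + b0, which conflict at s = 0. *)
Lemma in_xyf_monomial_socle_gen a b : (a + b)%N = N -> ~~ odd a -> 2%:R != 0 :> k ->
  ~ J ((s ^+ N.+1 - 1) * (x ^+ a.+2 * y ^+ b.+1)).
Proof.
move=> abN a_odd two_neq0.
pose E : B := 'X^(N.+1) - 1.
have sE : s ^+ N.+1 - 1 = scal E by rewrite /E scalD scalN scal1 scalX pol_sE.
have -> : (s ^+ N.+1 - 1) * (x ^+ a.+2 * y ^+ b.+1) =
    x * y * ((s ^+ N.+1 - 1) * (x ^+ a.+1 * y ^+ b)).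
  by move: (s ^+ N.+1 - 1) => e; rewrite !exprS; ring.
move=> /in_xyf_strip[al [be [ga]]]; rewrite sE => eqE.
have ev1 := congr1 (plane_eval 'X 'X) eqE.
have ev2 := congr1 (plane_eval (('X - 1)%:P * 'X) 'X) eqE.
rewrite (plane_eval_xy _ _ _ _ (plane_eval_g1 k)) 2!plane_evalM 2!plane_evalXn in ev1.
rewrite (plane_eval_xy _ _ _ _ (plane_eval_g2 k)) 2!plane_evalM 2!plane_evalXn in ev2.
rewrite plane_eval_x plane_eval_y plane_eval_scal in ev1.
rewrite plane_eval_x plane_eval_y plane_eval_scal in ev2.
have XN0 : 'X^(N.+1) != 0 :> {poly B} by rewrite expf_neq0 // polyX_eq0.
have := ev1; rewrite -exprD addSn abN -mulrDl => /(mulIf XN0)/(congr1 (fun v : {poly B} => v.[0])).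
have := ev2; rewrite !exprMn -[_ * _ * 'X^b]mulrA -exprD addSn abN !mulrA -mulrDl.
move=> /(mulIf XN0)/(congr1 (fun v : {poly B} => v.[0])).
have r0 : ((('X - 1)%:P * 'X) : {poly B}).[0] = 0 by rewrite hornerM hornerX mulr0.
rewrite -!polyC_exp 2!hornerD !hornerM !hornerC.
rewrite !plane_eval_00 ?hornerX //.
move: (al.[0].[0]) (be.[0].[0]) => a0 b0 E2 E1.
have E0 : E != 0 by rewrite monic_neq0 // monicXnsubC.
(* Eliminate b0 and multiply by r: the factor r^(N+2) - r is s E, so E cancels. *)
have : ('X - 1) * (('X - 1) ^+ a.+1 - 1) = 'X * a0.
  apply: (mulfI E0); rewrite mulrCA mulrBr mulr1 E2 {1}E1.
  have -> : ('X - 1) * (a0 * ('X - 1) ^+ N.+1 + b0 - (a0 + b0)) =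
    a0 * (('X - 1) ^+ N.+2 - ('X - 1)) by rewrite [_ ^+ N.+2]exprS; ring.
  by rewrite frobenius_s1 /E !exprS; ring.
(* At s = 0 one has r = -1, and a even makes the left side 2 while the right side is 0. *)
move=> /(congr1 (fun v : B => v.[0])); rewrite !(hornerE, horner_exp) /=.
rewrite -signr_odd /= a_odd expr1 => /eqP.
have -> : -1 * (-1 - 1) = 2%:R :> k by ring.
by apply/negP.
Qed.

End SocleGenerator.

(** * Transfer from polynomials to the quotient ring *)

Section ExampleRing.
Local Open Scope quotient_scope.
Variable k : fieldType.
Notation B := {poly k}.
Notation A := {poly {poly {poly k}}}.
Local Notation R := (exring k).
Local Notation s := (pol_s k).
Local Notation x := (pol_x k).
Local Notation y := (pol_y k).
Local Notation f := (pol_f k).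
Local Notation Jgen N := (ideal_gen [set ex_x k ^+ N; ex_y k ^+ N]).
Local Notation pp := (ideal_gen [set ex_x k; ex_y k]).

Definition to_exring (g : A) : R := \pi_{ideal_quot (@rel_ideal_pred k)} g.

Lemma to_exringD g h : to_exring (g + h) = to_exring g + to_exring h.
Proof. by rewrite /to_exring rmorphD. Qed.
Lemma to_exringN g : to_exring (- g) = - to_exring g.
Proof. by rewrite /to_exring rmorphN. Qed.
Lemma to_exringM g h : to_exring (g * h) = to_exring g * to_exring h.
Proof. by rewrite /to_exring rmorphM. Qed.
Lemma to_exringX g n : to_exring (g ^+ n) = to_exring g ^+ n.
Proof. by rewrite /to_exring rmorphXn. Qed.
Lemma to_exring1 : to_exring 1 = 1.
Proof. by rewrite /to_exring rmorph1. Qed.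

Lemma to_exring_eq g h : to_exring g = to_exring h <-> exists c, g - h = c * f.
Proof.
have -> : (exists c, g - h = c * f) <-> g - h \in @rel_ideal_pred k.
  by split => [/ideal_gen1P|?]; last exact/ideal_gen1P.
by rewrite Quotient.idealrBE; split=> [/eqP|/eqP].
Qed.

Lemma to_exring_in_xy N u : to_exring u \in Jgen N <-> in_xy x y f N u.
Proof.
split=> [/ideal_gen2P[c [d]]|[a [b [c uE]]]].
  elim/exringW: c => c; elim/exringW: d => d.
  rewrite -!/(to_exring _) -!to_exringX -!to_exringM -to_exringD => /to_exring_eq[e E].
  by exists c, d, e; rewrite -E addrC subrK.
apply/ideal_gen2P; exists (to_exring a), (to_exring b).
rewrite -!/(to_exring _) -!to_exringX -!to_exringM -to_exringD.
by apply/to_exring_eq; exists c; rewrite uE addrAC subrr add0r.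
Qed.

Lemma split_xy (g : A) : exists h h1, g = h * y + h1 * x + scal g.[0].[0].
Proof.
have [h gE] := poly_split g; have [h1 g0E] := poly_split g.[0].
by exists h, (h1%:P); rewrite {1}gE {1}g0E polyCD polyCM addrA.
Qed.

Lemma split_s (b : B) : exists h, scal b = scal h * s + scal (b.[0])%:P.
Proof.
have [h bE] := poly_split b.
by exists h; rewrite {1}bE scalD scalM -pol_sE.
Qed.

Lemma coef00_in_xyf N u : (0 < N)%N -> in_xy x y f N u -> u.[0].[0] = 0.
Proof.
move=> N0 [a [b [c uE]]].
have := congr1 (plane_eval 0 0) uE.
rewrite plane_eval_xy; last by rewrite pol_fE -mulrA plane_evalM plane_eval_x mul0r.
rewrite expr0n (negbTE (lt0n_neq0 N0)) !mulr0 addr0.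
move=> /(congr1 (fun v : {poly B} => v.[0])).
by rewrite plane_eval_00 !horner0.
Qed.

(** This is the exponent 1 case of [to_exring_in_xy]; it presents the ideal as the kernel of a map
    to the domain k[s], whence its primality. *)
Lemma to_exring_pp u : to_exring u \in pp <-> u.[0].[0] = 0.
Proof.
split=> [|u0]; first by move=> /(to_exring_in_xy 1)/coef00_in_xyf; apply.
apply/(to_exring_in_xy 1); have [h [h1 ->]] := split_xy u.
by rewrite u0; exists h1, h, 0; rewrite !expr1 /scal !polyC0; ring.
Qed.

Lemma pp_prime : is_prime pp.
Proof.
split=> [|u v].
  by apply/negP; rewrite -to_exring1 => /to_exring_pp/eqP; rewrite !hornerC oner_eq0.
elim/exringW: u => g; elim/exringW: v => h.
rewrite -!/(to_exring _) -to_exringM => /to_exring_pp/eqP.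
rewrite !hornerM mulf_eq0 => /orP[] /eqP /to_exring_pp ->; by rewrite ?orbT.
Qed.

Lemma pp_sub_m : {subset pp <= ex_m k}.
Proof.
by apply: ideal_gen_min => _ [->|->]; apply: mem_ideal_gen; [left; right|right].
Qed.

Lemma m_nsub_pp : ~ {subset ex_m k <= pp}.
Proof.
move=> H; have /H : ex_s k \in ex_m k by apply: mem_ideal_gen; left; left.
by move=> /to_exring_pp/eqP; rewrite !hornerC polyX_eq0.
Qed.

Lemma to_exring_m u : to_exring u \in ex_m k <-> u.[0].[0].[0] = 0.
Proof. by rewrite ex_mE eval0_pi; split=> /eqP. Qed.

Lemma exring_pchar p : p \in [pchar k] -> p \in [pchar R].
Proof.
move=> chark; apply: (rmorph_pchar \pi_{ideal_quot (@rel_ideal_pred k)}).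
by rewrite !pchar_poly.
Qed.

Section Exponent.
Variable N : nat.
Local Notation J := (in_xy x y f N.+2).
Hypothesis frobenius_s1 : ('X - 1) ^+ N.+2 = 'X ^+ N.+2 - 1 :> B.

(** The coefficient comes from the field k, so it is zero or a unit, as the length bounds
    require. *)
Lemma exring_s_torsion u i : ex_s k ^+ i * u \in Jgen N.+2 ->
  exists c, (c = 0 \/ exists d, d * c = 1) /\
    u - c * to_exring (socle_gen s x y N) \in Jgen N.+2.
Proof.
elim/exringW: u => u.
rewrite -!/(to_exring _) -to_exringX -to_exringM => /to_exring_in_xy.
move=> /(in_xyf_s_torsion frobenius_s1)[c Jc].
exists (to_exring (scal c%:P)); split; last first.
  by rewrite -to_exringM -to_exringN -to_exringD; apply/to_exring_in_xy.
have [->|c0] := eqVneq c 0; [left|right].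
  by rewrite /scal !polyC0; exact: (rmorph0 \pi_{ideal_quot (@rel_ideal_pred k)}).
exists (to_exring (scal (c^-1)%:P)).
by rewrite -to_exringM (scal_mulVf c0) to_exring1.
Qed.

End Exponent.

End ExampleRing.

(** * Elements with annihilators (x, y) and (s, x, y) *)

Section AssociatedPrimes.
Variable k : fieldType.

Notation B := {poly k}.
Local Notation R := (exring k).
Local Notation s := (pol_s k).
Local Notation x := (pol_x k).
Local Notation y := (pol_y k).
Local Notation f := (pol_f k).
Local Notation Jgen N := (ideal_gen [set ex_x k ^+ N; ex_y k ^+ N]).
Local Notation pp := (ideal_gen [set ex_x k; ex_y k]).

Variable N : nat.
Local Notation J := (in_xy x y f N.+2).
Hypothesis frobenius_s1 : ('X - 1) ^+ N.+2 = 'X ^+ N.+2 - 1 :> B.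
Variables a b : nat.
Hypothesis abN : (a.+1 + b)%N = N.

(** Multiplying by x or y raises the monomial to the degree of w, where s^(N+2) - s kills it. What
    remains of g is g(s, 0, 0), which must vanish by torsion-freeness in degree N+2. *)
Lemma pp_annihilator (g : R) :
  g \in pp <->
  g * to_exring ((s ^+ N.+2 - s) * (x ^+ a.+2 * y ^+ b.+1)) \in Jgen N.+2.
Proof.
elim/exringW: g => g; rewrite -!/(to_exring _) -to_exringM.
apply: (iff_trans (to_exring_pp g)); apply: iff_trans (iff_sym (to_exring_in_xy _ _)).
have fr := frobenius_s frobenius_s1.
pose z := (s ^+ N.+2 - s) * (x ^+ a.+2 * y ^+ b.+1).
have Jx : J (x * z).
  have -> : x * z = (s ^+ N.+2 - s) * (x ^+ a.+3 * y ^+ b.+1).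
    by rewrite /z [x ^+ a.+3]exprS; ring.
  by have H := in_xy_sN_monomial (pol_fE k) fr abN; exact: H.
have Jy : J (y * z).
  have abN' : (a + b.+1)%N = N by rewrite addnS -addSn.
  have -> : y * z = (s ^+ N.+2 - s) * (x ^+ a.+2 * y ^+ b.+2).
    by rewrite /z [y ^+ b.+2]exprS; ring.
  by have H := in_xy_sN_monomial (pol_fE k) fr abN'; exact: H.
have [h [h1 gE]] := split_xy g.
have J1 : J (h * (y * z) + h1 * (x * z)) by apply: in_xyD; apply: in_xyMl.
split=> [g0|]; rewrite gE -/z.
  by move: J1; congr in_xy; rewrite g0 /scal !polyC0; ring.
move=> /in_xyB/(_ J1) Jg.
have {}Jg : J (scal (g.[0].[0] * ('X^(N.+2) - 'X)) * (x ^+ a.+2 * y ^+ b.+1)).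
  move: Jg; congr in_xy; rewrite scalM scalD scalN scalX -pol_sE /z.
  by move: (s ^+ _) (scal _) => *; ring.
have abN' : (a.+1 + b)%N = N by [].
have X0 : 'X^(N.+2) - 'X != 0 :> B.
  apply/eqP => /subr0_eq/(congr1 (fun v : B => size v)).
  by rewrite size_polyXn size_polyX.
have /eqP := in_xyf_monomial_torsion_free abN' Jg.
by rewrite -gE mulf_eq0 (negPf X0) orbF => /eqP.
Qed.

(** The element is killed by s, x, y, so only the constant g(0, 0, 0) matters; if nonzero it would
    be invertible and put the element in J. *)
Lemma m_annihilator (g : R) : odd a -> 2%:R != 0 :> k ->
  g \in ex_m k <->
  g * to_exring ((s ^+ N.+1 - 1) * (x ^+ a.+3 * y ^+ b.+1)) \in Jgen N.+2.
Proof.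
move=> a_odd two_neq0; elim/exringW: g => g; rewrite -!/(to_exring _) -to_exringM.
apply: (iff_trans (to_exring_m g)); apply: iff_trans (iff_sym (to_exring_in_xy _ _)).
have fr := frobenius_s frobenius_s1.
have [Js Jx Jy] := in_xy_killed_monomial (pol_fE k) fr abN.
have nJ : ~ J ((s ^+ N.+1 - 1) * (x ^+ a.+3 * y ^+ b.+1)).
  by apply: in_xyf_monomial_socle_gen => //=; rewrite a_odd.
move: Js Jx Jy nJ; move: ((s ^+ N.+1 - 1) * _) => z Js Jx Jy nJ.
have [h [h1 gE]] := split_xy g; have [h2 g0E] := split_s g.[0].[0].
rewrite g0E in gE.
have J1 : J (h * (y * z) + h1 * (x * z) + scal h2 * (s * z)).
  by apply: in_xyD; [apply: in_xyD|]; apply: in_xyMl.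
split=> [g0|]; rewrite gE.
  by move: J1; congr in_xy; rewrite g0 /scal !polyC0; ring.
move=> /in_xyB/(_ J1) Jg; rewrite -gE; apply/eqP; apply: contraT => c0; case: nJ.
have := in_xyMl (scal (g.[0].[0].[0]^-1)%:P) Jg; congr in_xy.
set c := g.[0].[0].[0] in c0 *.
have cc := scal_mulVf c0.
transitivity (scal (c^-1)%:P * scal c%:P * z); last by rewrite cc mul1r.
by move: (scal h2) (scal c%:P) (scal (c^-1)%:P) => *; ring.
Qed.

End AssociatedPrimes.

(** * Frobenius powers in the example and the final assembly *)

Lemma frobenius_X_sub1 (k : fieldType) p e : p \in [pchar k] -> odd p ->
  ('X - 1) ^+ (p ^ e) = 'X ^+ (p ^ e) - 1 :> {poly k}.
Proof.
move=> char_k p_odd; rewrite exprDn_pchar.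
  by rewrite -[(-1) ^+ _]signr_odd oddX p_odd orbT expr1.
by rewrite pnatX (pnatE _ (pcharf_prime char_k)) pchar_poly char_k.
Qed.

(** The monomial is the q-th power of a b^n, a product of n+1 generators. *)
Lemma monomial_in_frobenius_power (S : comNzRingType) (a b : S) n q :
  a ^+ q * b ^+ (n * q) \in
    frobenius_power (ideal_exp (ideal_gen [set a; b]) n.+1) q.
Proof.
rewrite exprM -exprMn; apply: mem_ideal_gen; exists (a * b ^+ n) => //.
apply: ideal_mulI; first by apply: mem_ideal_gen; left.
by apply: ideal_expI; apply: mem_ideal_gen; right.
Qed.

Theorem mainTheorem2 (F : realType) (p : nat) (k : fieldType)
    (p_prime : prime p) (p_odd : odd p) (char_k : p \in [pchar k]) :
  let R := exring k in
  let J : ideal R := ideal_gen [set ex_x k ^+ p; ex_y k ^+ p] in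
  let I : ideal R := ideal_exp (ideal_gen [set ex_x k; ex_y k]) p in
  let pp : ideal R := ideal_gen [set ex_x k; ex_y k] in
  let mm : ideal R := ex_m k in
  (is_prime pp /\ is_prime mm /\
     {subset pp <= mm} /\ ~ {subset mm <= pp}) /\
  (forall e : nat, (1 <= e)%N ->
     let q := (p ^ e)%N in
     let M := subquot (frobenius_power I q) (frobenius_power J q) in
     (associated_prime M pp /\ associated_prime M mm) /\
     (mod_length F (submod_type (mod_torsion M mm)) <= 1)%E) /\
  (let ext := @ideal_ext R (ex_loc k) (@to_ex_loc k) in
   rel_mult_is p (ext mm) (ext J) (ext I) (0%E : \bar F)).
Proof.
move=> R J I pp mm.
have char_R := exring_pchar char_k.
have p3 : (2 < p)%N by apply: odd_prime_gt2.
have Npos e : exists N, (p * p ^ e)%N = N.+2.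
  exists (p * p ^ e).-2; rewrite -subn2 -addn2 subnK //.
  by rewrite (leq_trans (ltnW p3)) // leq_pmulr // expn_gt0 prime_gt0.
have frob e : ('X - 1) ^+ (p * p ^ e) = 'X ^+ (p * p ^ e) - 1 :> {poly k}.
  by rewrite -expnS frobenius_X_sub1.
have JE e : frobenius_power J (p ^ e) =i
    ideal_gen [set ex_x k ^+ (p * p ^ e); ex_y k ^+ (p * p ^ e)].
  by apply: frobenius_power_gen2.
split; first by split; [exact: pp_prime|split; [exact: ex_m_prime|split;
  [exact: pp_sub_m|exact: m_nsub_pp]]].
split.
- move=> e e1 q M; have [N NE] := Npos e; have frN := frob e; rewrite NE in frN.
  split; last first.
    apply: (@torsion_length_le1 _ F _ _ _ (to_exring (socle_gen (pol_s k) (pol_x k) (pol_y k) N))).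
    (* Torsion is tested only on s^i, a member of m^i. *)
    move=> u i _ /(_ (ex_s k ^+ i)); rewrite !JE NE => tors.
    have [|c [c1 cJ]] := exring_s_torsion frN (u := u) (i := i).
      by apply: tors; apply: ideal_expI; apply: mem_ideal_gen; left; left.
    by exists c; rewrite JE NE.
  have q3 : (2 < q)%N.
    by rewrite (leq_trans p3) // -{1}[p]expn1 leq_exp2l // prime_gt1.
  have q_odd : odd q by rewrite oddX p_odd orbT.
  (* The choice a = q - 2, b = (p - 1)q - 1 makes x^(a+2) y^(b+1) equal to x^q y^((p-1)q), an
     element of I^[q]; a is odd because q is. *)
  have [a qE] : exists a, q = a.+2 by exists (q - 2)%N; lia.
  have [p' pE] : exists p', p = p'.+2 by exists (p - 2)%N; lia.
  have [b bE] : exists b, (p'.+1 * q)%N = b.+1.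
    by exists (p'.+1 * q).-1; rewrite prednK // muln_gt0 /= (ltn_trans _ q3).
  have abN : (a.+1 + b)%N = N.
    apply: succn_inj; apply: succn_inj; rewrite -NE -/q {1}pE mulSn bE qE; lia.
  have memI u : to_exring (u * (pol_x k ^+ a.+2 * pol_y k ^+ b.+1)) \in frobenius_power I q.
    rewrite to_exringM; apply: idealMl; rewrite to_exringM !to_exringX -qE -bE.
    by rewrite /I pE; apply: monomial_in_frobenius_power.
  split.
    apply: (associated_prime_subquot (@pp_prime k) (memI (pol_s k ^+ N.+2 - pol_s k))) => g.
    by rewrite JE NE; apply: pp_annihilator.
  have memI' : to_exring ((pol_s k ^+ N.+1 - 1) * (pol_x k ^+ a.+3 * pol_y k ^+ b.+1))
      \in frobenius_power I q.
    have := memI ((pol_s k ^+ N.+1 - 1) * pol_x k).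
    by rewrite -!mulrA [pol_x k * _]mulrA -exprS.
  apply: (associated_prime_subquot (@ex_m_prime k) memI') => g.
  rewrite JE NE; apply: m_annihilator => //; first by move: q_odd; rewrite qE /= negbK.
  by rewrite -(dvdn_pcharf char_k) gtnNdvd.
- move=> ext; apply: rel_mult_is0; first exact: prime_gt1.
    exact: (krull_dim_localization_ge1 (@ex_m_prime k) F (@pp_prime k)
      (@pp_sub_m k) (@m_nsub_pp k)).
  move=> e; have [N NE] := Npos e; have frN := frob e; rewrite NE in frN.
  apply: (@localization_torsion_length_le1 _ _ (@ex_m_prime k) F _ _
    (ideal_gen [set ex_x k ^+ N.+2; ex_y k ^+ N.+2]) _ (ex_s k)).
  - by apply: mem_ideal_gen; left; left.
  (* The Frobenius power of the extended J and the extension of (x^(pq), y^(pq)) have the same two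
     generators. *)
  - move=> z; rewrite (@frobenius_power_gen2 _ p e (to_ex_loc (ex_x k)) (to_ex_loc (ex_y k))).
    + by rewrite ideal_ext_gen2 NE !to_locX.
    + exact: localization_pchar.
    + by move=> w; rewrite ideal_ext_gen2 !to_locX.
  - exact: exring_s_torsion.
Qed.
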